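(* Let $(p,q,r)$ be a triple of pairwise relatively prime integers with $1<p<q<r$. Let $(e_0,p',q',r')$ be the integers determined by $$e_0pqr+p'qr+pq'r+pqr'=-1,\qquad 0\le p'\le p-1,\ 0\le q'\le q-1,\ 0\le r'\le r-1,$$ and define $\Delta:\mathbb{N}\to\mathbb{Z}$ (with $0\in\mathbb{N}$) by $$\Delta(n)=1+|e_0|n-\left\lceil\frac{np'}{p}\right\rceil-\left\lceil\frac{nq'}{q}\right\rceil-\left\lceil\frac{nr'}{r}\right\rceil .$$ Put $N_0=pqr-pq-qr-pr$. Suppose $(p,q,r)\neq(2,3,5)$. Then: 1. $N_0$ is a positive integer. 2. $\Delta(n)\ge 0$ for all $n>N_0$. 3. $\Delta(n)=-\Delta(N_0-n)$ for all $n$ with $0\le n\le N_0$. 4. $\Delta(n)\in\{-1,0,1\}$ for all $n$ with $0\le n\le N_0$. 5. For $0\le n\le N_0$, one has $\Delta(n)=1$ if and only if $n$ is an element of the numerical semigroup $G(pq,pr,qr)$ minimally generated by $pq$, $pr$ and $qr$. If $(p,q,r)=(2,3,5)$, then $\Delta(n)\ge 0$ for all $n\in\mathbb{N}$.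
   Context: $\lceil y\rceil$ is the least integer greater than or equal to $y$. The semigroup $G(pq,pr,qr)=\{a\,pq+b\,pr+c\,qr : a,b,c\in\mathbb{Z}_{\ge 0}\}$ contains $0$. *)

(* Defs.v *)
From HB Require Import structures.
From mathcomp Require Import all_boot all_order all_algebra.
Set Implicit Arguments.
Unset Strict Implicit.
Unset Printing Implicit Defensive.
Import Order.TTheory GRing.Theory Num.Theory.
Local Open Scope ring_scope.

Definition Delta (p q r : nat) (e0 p' q' r' : int) (n : nat) : int :=
  1 + `|e0| * n%:Z
    - Num.ceil (n%:Q * p'%:Q / p%:Q)
    - Num.ceil (n%:Q * q'%:Q / q%:Q)
    - Num.ceil (n%:Q * r'%:Q / r%:Q).

(* Integer-valued, since it is negative for (2, 3, 5). *)
Definition N0 (p q r : nat) : int :=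
  p%:Z * q%:Z * r%:Z - p%:Z * q%:Z - q%:Z * r%:Z - p%:Z * r%:Z.

Definition G (x y z n : nat) : Prop :=
  exists a b c : nat, n = (a * x + b * y + c * z)%N.

Definition numerical_semigroup (S : nat -> Prop) : Prop :=
  [/\ S 0%N,
      forall m n : nat, S m -> S n -> S (m + n)%N
    & exists m : nat, forall n : nat, (m <= n)%N -> S n].

Definition generates (gens : seq nat) (S : nat -> Prop) : Prop :=
  forall n : nat,
    S n <-> exists c : nat -> nat, n = (\sum_(g <- gens) c g * g)%N.

Definition minimally_generates (gens : seq nat) (S : nat -> Prop) : Prop :=
  generates gens S /\
  forall s : seq nat,
    {subset s <= gens} -> generates s S -> {subset gens <= s}.

(* Main.v *)
(* Multiplying Delta(n) by pqr turns the three ceilings into residues: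
   n = a qr + b pr + c pq + (Delta(n) - 1) pqr with 0 <= a < p, 0 <= b < q and
   0 <= c < r, and by the Chinese remainder theorem this representation is
   unique.  The symmetry n |-> N0 - n sends a, b, c to p-1-a, q-1-b, r-1-c, and
   n lies in the semigroup exactly when the coefficient of pqr is nonnegative. *)
Require Import Defs.
From HB Require Import structures.
From mathcomp Require Import all_boot all_order all_algebra.
From mathcomp Require Import zify ring.
Import Order.TTheory GRing.Theory Num.Theory.
Local Open Scope ring_scope.

Set Implicit Arguments.
Unset Strict Implicit.
Unset Printing Implicit Defensive.

(** Here [t] stands for Delta(n) - 1. Everything lives in [int], so the reflection n |-> N0 - n
    needs no bound on [n]. *)
Definition mixed_rep (p q r n t : int) : Prop :=
  exists a b c : int, [/\ 0 <= a < p, 0 <= b < q, 0 <= c < r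
    & n = a * (q * r) + b * (p * r) + c * (p * q) + t * (p * q * r)].

Lemma ceil_divz (m k a p : int) : 0 <= a < p -> p * k = m + a ->
  Num.ceil (m%:Q / p%:Q) = k.
Proof.
move=> ha hk; have p0 : 0 < p by lia.
have p0' : 0 < p%:Q by rewrite ltr0z.
apply: ceil_def; rewrite ltr_pdivlMr // ler_pdivrMr // -!intrM ltr_int ler_int.
by apply/andP; split; lia.
Qed.

Lemma ceil_divz_residue (m p : int) : 0 < p ->
  exists2 a, 0 <= a < p & p * Num.ceil (m%:Q / p%:Q) = m + a.
Proof.
move=> p0; have ha : 0 <= (- m %% p)%Z < p.
  by rewrite modz_ge0 ?ltz_pmod ?gt_eqF.
(* The ceiling of m/p is minus the floor of -m/p, so the residue is that of [- m] modulo [p]. *)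
have hk : p * - (- m %/ p)%Z = m + (- m %% p)%Z.
  by have := divz_eq (- m) p; lia.
by exists (- m %% p)%Z; rewrite // (ceil_divz ha hk).
Qed.

(** Modulo [p] the factor [u] is invertible, so [p] divides [a - a'], whose absolute value is below
    [p]. *)
Lemma eq_coef_coprimez (p u a a' x y : int) : coprimez p u ->
  0 <= a < p -> 0 <= a' < p -> a * u + p * x = a' * u + p * y -> a = a'.
Proof.
move=> co ha ha' e.
have : (p %| (a - a') * u)%Z.
  by apply/dvdzP; exists (y - x); rewrite mulrBl mulrBl; lia.
rewrite Gauss_dvdzl // => /dvdzP[k hk].
have [k0|[k0|k0]] : k = 0 \/ k <= -1 \/ 1 <= k by lia.
- by rewrite k0 in hk; lia.
- by nia.
- by nia.
Qed.

(** Modulo [p] only the term in qr survives and fixes [a]; likewise [b] modulo [q] and [c] modulo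
    [r]. Cancelling pqr then fixes [t]. *)
Lemma mixed_rep_inj (p q r n t t' : int) :
  coprimez p q -> coprimez p r -> coprimez q r -> 0 < p -> 0 < q -> 0 < r ->
  mixed_rep p q r n t -> mixed_rep p q r n t' -> t = t'.
Proof.
move=> cpq cpr cqr p0 q0 r0 [a [b [c [ha hb hc ->]]]] [a' [b' [c' [ha' hb' hc' e]]]].
have ea : a = a'.
  apply: (@eq_coef_coprimez p (q * r) a a' (b * r + c * q + t * q * r)
    (b' * r + c' * q + t' * q * r)) => //; first by rewrite coprimezMr cpq.
  by lia.
have eb : b = b'.
  apply: (@eq_coef_coprimez q (p * r) b b' (a * r + c * p + t * p * r)
    (a' * r + c' * p + t' * p * r)) => //.
    by rewrite coprimezMr cqr coprimez_sym cpq.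
  by move: e; rewrite ea; lia.
have ec : c = c'.
  apply: (@eq_coef_coprimez r (p * q) c c' (a * q + b * p + t * p * q)
    (a' * q + b' * p + t' * p * q)) => //.
    by rewrite coprimezMr !(coprimez_sym r) cpr cqr.
  by move: e; rewrite ea eb; lia.
move: e; rewrite ea eb ec => /addrI /mulIf; apply.
by rewrite !mulf_neq0 ?gt_eqF.
Qed.

(** The largest coefficients give (p-1)qr + (q-1)pr + (r-1)pq = N0 + 2pqr, whence the shift by 2.
    For t = Delta - 1 the new coefficient is - Delta - 1, so Delta changes sign. *)
Lemma mixed_rep_reflect (p q r n t : int) : mixed_rep p q r n t ->
  mixed_rep p q r (p * q * r - p * q - q * r - p * r - n) (- t - 2).
Proof.
move=> [a [b [c [ha hb hc ->]]]].
exists (p - 1 - a), (q - 1 - b), (r - 1 - c); split; [lia|lia|lia|ring].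
Qed.

Lemma mixed_rep_le (p q r n t : int) :
  0 < p -> 0 < q -> 0 < r -> mixed_rep p q r n t -> t * (p * q * r) <= n.
Proof.
move=> p0 q0 r0 [a [b [c [/andP[a0 _] /andP[b0 _] /andP[c0 _] ->]]]].
by rewrite lerDr !addr_ge0 // !mulr_ge0 // ltW.
Qed.

Lemma mixed_rep_ge (p q r n t : int) :
  0 < p -> 0 < q -> 0 < r -> mixed_rep p q r n t ->
  n <= p * q * r - p * q - q * r - p * r + (t + 2) * (p * q * r).
Proof.
by move=> p0 q0 r0 /mixed_rep_reflect/(mixed_rep_le p0 q0 r0); lia.
Qed.

Lemma mixed_rep_sum (p q r a b c : int) :
  0 < p -> 0 < q -> 0 < r -> 0 <= a -> 0 <= b -> 0 <= c ->
  exists2 t, 0 <= t &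
    mixed_rep p q r (a * (q * r) + b * (p * r) + c * (p * q)) t.
Proof.
(* Reducing each coefficient carries its quotient into the coefficient of pqr. *)
move=> p0 q0 r0 a0 b0 c0; exists ((a %/ p)%Z + (b %/ q)%Z + (c %/ r)%Z).
  by rewrite !addr_ge0 // divz_ge0.
exists (a %% p)%Z, (b %% q)%Z, (c %% r)%Z.
split; rewrite ?modz_ge0 ?ltz_pmod ?gt_eqF //.
rewrite {1}(divz_eq a p) {1}(divz_eq b q) {1}(divz_eq c r); ring.
Qed.

Lemma mixed_rep_Delta (p q r : nat) (e0 p' q' r' : int) (n : nat) :
  (0 < p)%N -> (0 < q)%N -> (0 < r)%N ->
  0 <= p' -> 0 <= q' -> 0 <= r' ->
  e0 * p%:Z * q%:Z * r%:Z + p' * q%:Z * r%:Z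
    + p%:Z * q' * r%:Z + p%:Z * q%:Z * r' = -1 ->
  mixed_rep p q r n (Delta p q r e0 p' q' r' n - 1).
Proof.
move=> p0 q0 r0 p'0 q'0 r'0 he.
(* A positive [e0] would make the left side of the defining equation nonnegative; hence |e0| = -
   e0. *)
have e0n : e0 <= 0.
  rewrite leNgt; apply/negP => e0p.
  suff: 0 <= -1 :> int by [].
  by rewrite -he !addr_ge0 // !mulr_ge0 // ltW.
have [a ha ka] := @ceil_divz_residue (n%:Z * p') p p0.
have [b hb kb] := @ceil_divz_residue (n%:Z * q') q q0.
have [c hc kc] := @ceil_divz_residue (n%:Z * r') r r0.
exists a, b, c; split=> //.
rewrite /Delta ler0_norm // -!intrM.
move: ka kb kc; set A := Num.ceil _; set B := Num.ceil _; set C := Num.ceil _.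
move=> ka kb kc.
have {ka} -> : a = p%:Z * A - n%:Z * p' by rewrite ka; ring.
have {kb} -> : b = q%:Z * B - n%:Z * q' by rewrite kb; ring.
have {kc} -> : c = r%:Z * C - n%:Z * r' by rewrite kc; ring.
(* The defining equation times - n expresses [n]; the ceilings [A], [B], [C] cancel between the
   residues and Delta. *)
have := congr1 (fun x => - (n%:Z * x)) he.
by rewrite mulrN1 opprK => hn; rewrite -[LHS]hn; ring.
Qed.

Lemma mixed_rep_G (p q r : nat) (n : nat) (t : int) :
  0 <= t -> mixed_rep p q r n t -> G (p * q) (p * r) (q * r) n.
Proof.
move=> t0 [a [b [c [/andP[a0 _] /andP[b0 _] /andP[c0 _] e]]]].
(* The term in pqr is absorbed as [t * r] further copies of pq. *)
exists (`|c| + `|t| * r)%N, `|b|%N, `|a|%N.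
apply/eqP; rewrite -eqz_nat e !(PoszD, PoszM) !gez0_abs //.
by apply/eqP; ring.
Qed.

Lemma G_mixed_rep (p q r : nat) (n : nat) :
  (0 < p)%N -> (0 < q)%N -> (0 < r)%N -> G (p * q) (p * r) (q * r) n ->
  exists2 t : int, 0 <= t & mixed_rep p q r n t.
Proof.
move=> p0 q0 r0 [a [b [c ->]]].
have [t t0 ht] := @mixed_rep_sum p q r c b a p0 q0 r0 isT isT isT.
exists t => //; suff -> : (a * (p * q) + b * (p * r) + c * (q * r))%N%:Z =
  c%:Z * (q%:Z * r) + b%:Z * (p%:Z * r) + a%:Z * (p%:Z * q) by [].
by rewrite !(PoszD, PoszM); ring.
Qed.

Lemma generates_G (x y z : nat) : uniq [:: x; y; z] ->
  generates [:: x; y; z] (G x y z).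
Proof.
rewrite /= !inE negb_or => /andP[/andP[xy xz] /andP[yz _]] n; split.
  move=> [a [b [c ->]]].
  (* As the generators are distinct, one function of the generator can carry three independent
     coefficients. *)
  exists (fun g => if g == x then a else if g == y then b else c).
  rewrite !big_cons big_nil eqxx (eq_sym y x) (negPf xy) eqxx.
  by rewrite (eq_sym z x) (negPf xz) (eq_sym z y) (negPf yz) addn0 addnA.
move=> [c ->]; exists (c x), (c y), (c z).
by rewrite !big_cons big_nil addn0 addnA.
Qed.

(** If [g] were missing from [s], then [d] would divide all of [s], hence every combination, hence
    [g]. *)
Lemma generates_mem (S : nat -> Prop) (s : seq nat) (g d : nat) :
  generates s S -> S g -> ~~ (d %| g)%N ->
  (forall h, h \in s -> h != g -> (d %| h)%N) -> g \in s.
Proof.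
move=> gs /gs[c eg] ndvd dvds; apply: contraNT ndvd => gns.
rewrite {1}eg big_seq; apply: dvdn_sum => h hs.
by apply/dvdn_mull/dvds => //; apply: contraNneq gns => <-.
Qed.

Lemma coprime_ndvd_mul (d x y : nat) : (1 < d)%N -> coprime d x ->
  coprime d y -> ~~ (d %| x * y)%N.
Proof.
move=> d1 cx cy; rewrite Gauss_dvdr //; apply: contraL cy => /gcdn_idPl.
by rewrite /coprime => ->; rewrite neq_ltn d1 orbT.
Qed.

(** Each of [p], [q], [r] divides two of the products but not the third, so that third one cannot be
    dropped. *)
Lemma minimally_generates_G (p q r : nat) :
  coprime p q -> coprime p r -> coprime q r ->
  (1 < p)%N -> (1 < q)%N -> (1 < r)%N -> uniq [:: p * q; p * r; q * r]%N ->
  minimally_generates [:: p * q; p * r; q * r]%N (G (p * q) (p * r) (q * r)).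
Proof.
move=> cpq cpr cqr p1 q1 r1 u; split; first exact: generates_G.
move=> s sub gs g; rewrite !inE => /or3P[] /eqP ->.
- apply: (@generates_mem _ s _ r gs).
  + by exists 1%N, 0%N, 0%N; rewrite !mul0n mul1n !addn0.
  + by apply: coprime_ndvd_mul; rewrite // coprime_sym.
  + move=> h /sub; rewrite !inE => /or3P[] /eqP-> //; first by rewrite eqxx.
      by rewrite dvdn_mull.
    by rewrite dvdn_mull.
- apply: (@generates_mem _ s _ q gs).
  + by exists 0%N, 1%N, 0%N; rewrite !mul0n mul1n !addn0.
  + by apply: coprime_ndvd_mul; rewrite // coprime_sym.
  + move=> h /sub; rewrite !inE => /or3P[] /eqP-> //; last by rewrite dvdn_mulr.
      by rewrite dvdn_mull.
    by rewrite eqxx.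
- apply: (@generates_mem _ s _ p gs).
  + by exists 0%N, 0%N, 1%N; rewrite !mul0n mul1n.
  + exact: coprime_ndvd_mul.
  + move=> h /sub; rewrite !inE => /or3P[] /eqP-> //; rewrite ?eqxx //.
      by rewrite dvdn_mulr.
    by rewrite dvdn_mulr.
Qed.

(** For p >= 3, pqr >= 3qr exceeds the sum of the three products. For p = 2, N0 = (q-2)(r-2) - 4,
    which is positive once q >= 5. *)
Lemma N0_gt0 (p q r : nat) : coprime p q -> coprime p r -> coprime q r ->
  (1 < p)%N -> (p < q)%N -> (q < r)%N -> (p, q, r) <> (2, 3, 5)%N ->
  0 < N0 p q r.
Proof.
move=> cpq cpr cqr p1 pq qr ne; rewrite /N0.
have [p3|p2] : (2 < p)%N \/ p = 2%N by lia.
  by nia.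
subst p; rewrite !coprime2n in cpq cpr.
have [q5|q3] : (4 < q)%N \/ q = 3%N by lia.
  by nia.
subst q; have r4 : r != 5%N by apply/eqP => r5; apply: ne; rewrite r5.
(* Now N0 = r - 6; coprimality excludes r = 4 and r = 6, the hypothesis r = 5. *)
have : (r <= 6)%N -> false by move: r cqr cpr qr r4 {ne}; do 7?[case=> //].
by lia.
Qed.

Theorem theorem1p3 (p q r : nat)
  (hpq : coprime p q) (hpr : coprime p r) (hqr : coprime q r)
  (h1p : (1 < p)%N) (hltpq : (p < q)%N) (hltqr : (q < r)%N)
  (e0 p' q' r' : int)
  (he : e0 * p%:Z * q%:Z * r%:Z + p' * q%:Z * r%:Z
        + p%:Z * q' * r%:Z + p%:Z * q%:Z * r' = -1)
  (hp' : 0 <= p' <= p%:Z - 1)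
  (hq' : 0 <= q' <= q%:Z - 1)
  (hr' : 0 <= r' <= r%:Z - 1) :
  ((p, q, r) <> (2, 3, 5)%N ->
    [/\ 0 < N0 p q r,
        forall n : nat, N0 p q r < n%:Z -> 0 <= Delta p q r e0 p' q' r' n,
        forall n : nat, n%:Z <= N0 p q r ->
          Delta p q r e0 p' q' r' n
            = - Delta p q r e0 p' q' r' `|N0 p q r - n%:Z|%N,
        forall n : nat, n%:Z <= N0 p q r ->
          Delta p q r e0 p' q' r' n \in [:: -1; 0; 1]
      & [/\ numerical_semigroup (G (p * q) (p * r) (q * r)),
            minimally_generates [:: p * q; p * r; q * r]%N
              (G (p * q) (p * r) (q * r))
          & forall n : nat, n%:Z <= N0 p q r ->
              (Delta p q r e0 p' q' r' n = 1
                <-> G (p * q) (p * r) (q * r) n)]])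
  /\ ((p, q, r) = (2, 3, 5)%N ->
       forall n : nat, 0 <= Delta p q r e0 p' q' r' n).
Proof.
have p0 : (0 < p)%N by lia.
have q0 : (0 < q)%N by lia.
have r0 : (0 < r)%N by lia.
have pz : 0 < p%:Z by [].
have qz : 0 < q%:Z by [].
have rz : 0 < r%:Z by [].
have P0 : 0 < p%:Z * q%:Z * r%:Z by rewrite !mulr_gt0.
pose D n := Delta p q r e0 p' q' r' n.
have rep (n : nat) : mixed_rep p q r n (D n - 1).
  by apply: mixed_rep_Delta => //; lia.
have inj n t t' := @mixed_rep_inj p q r n t t' hpq hpr hqr pz qz rz.
(* If D n <= -1, the upper bound n <= N0 + (D n + 1)pqr gives n <= N0. *)
have D_ge0 (n : nat) : N0 p q r < n%:Z -> 0 <= D n.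
  rewrite /N0 => hn; have := mixed_rep_ge pz qz rz (rep n); nia.
split; last first.
  (* Here N0 = -1, so every natural number exceeds it. *)
  by case=> ep eq er n; apply: D_ge0; rewrite ep eq er.
move=> ne; have N0p : 0 < N0 p q r by apply: N0_gt0.
have N0lt : N0 p q r < p%:Z * q%:Z * r%:Z by rewrite /N0; nia.
(* (D n - 1)pqr <= n < pqr forces D n - 1 <= 0. *)
have D_le1 (n : nat) : n%:Z <= N0 p q r -> D n <= 1.
  by move=> hn; have := mixed_rep_le pz qz rz (rep n); nia.
have D_sym (n : nat) : n%:Z <= N0 p q r -> D n = - D `|N0 p q r - n%:Z|%N.
  move=> hn; have e : `|N0 p q r - n%:Z|%N%:Z = N0 p q r - n%:Z.
    by rewrite gez0_abs ?subr_ge0.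
  have := rep `|N0 p q r - n%:Z|%N; rewrite e => h.
  have := inj _ _ _ h (mixed_rep_reflect (rep n)); lia.
split=> //.
  (* The lower bound -1 is the upper bound 1 at the reflected argument. *)
  move=> n hn; have h1 := D_le1 n hn; have h2 := D_sym n hn.
  have h3 : D `|N0 p q r - n%:Z|%N <= 1 by apply: D_le1; lia.
  rewrite -/(D n) !inE; lia.
split.
- split.
  + by exists 0%N, 0%N, 0%N.
  + move=> m n [a [b [c ->]]] [a' [b' [c' ->]]].
    by exists (a + a')%N, (b + b')%N, (c + c')%N; rewrite !mulnDl; lia.
  (* Since N0 < pqr, n < (D n + 2)pqr, so from 3pqr on D n - 1 is nonnegative. *)
  + exists (3 * (p * q * r))%N => n hn.
    apply: mixed_rep_G (rep n).
    have := mixed_rep_ge pz qz rz (rep n); nia.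
- apply: minimally_generates_G => //; try lia.
  by rewrite /= !inE !negb_or; nia.
- move=> n hn; rewrite -/(D n); split => [Dn|].
    by apply: mixed_rep_G (rep n); rewrite Dn subrr.
  (* By uniqueness D n - 1 = t >= 0, and D n <= 1 leaves only D n = 1. *)
  case/(G_mixed_rep p0 q0 r0) => t t0 ht.
  by have := inj _ _ _ (rep n) ht; have := D_le1 n hn; lia.
Qed.
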